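(* Let $\mathbf{f}=(f_1,f_2):\mathbb{R}^2\to\mathbb{R}^2$ be a continuously differentiable vector field. Consider the problem of minimizing $\int_0^1(u_1^2+u_2^2)\,dt$ over the trajectories of $$\dot{x}_1=u_1,\quad \dot{x}_2=u_2,\quad \dot{x}_3=f_1(x_1,x_2)u_1+f_2(x_1,x_2)u_2,$$ and the associated augmented Lagrangian $$L=\dot{x}_1^2+\dot{x}_2^2+\lambda\bigl(\dot{x}_3-f_1(x_1,x_2)\dot{x}_1-f_2(x_1,x_2)\dot{x}_2\bigr).$$ If $(x_1,x_2,x_3,\lambda)$ satisfies the Euler-Lagrange equations of $L$, then $\lambda$ is constant and, writing $\mathbf{x}=(x_1,x_2)$, there is a constant $\mu\in\mathbb{R}$ (namely $\mu=\lambda/2$) such that $$\ddot{\mathbf{x}}=\mu\,(\nabla\times\mathbf{f})\times\dot{\mathbf{x}},$$ i.e. $\mathbf{x}$ satisfies the equation of motion of a charged particle in the magnetic field $\nabla\times\mathbf{f}$.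
   Context: The functions $x_1,x_2,x_3$ of $t\in[0,1]$ are twice continuously differentiable and $\lambda$ is a continuously differentiable function of $t$; the Euler-Lagrange equations of $L$ are taken with respect to all of $x_1,x_2,x_3,\lambda$. Vectors in the $x_1$-$x_2$ plane are regarded as vectors in $\mathbb{R}^3$ with unit vectors $\hat{i},\hat{j},\hat{k}$: $\nabla\times\mathbf{f}=\left(\frac{\partial f_2}{\partial x_1}-\frac{\partial f_1}{\partial x_2}\right)\hat{k}$ and $\dot{\mathbf{x}}=\dot{x}_1\hat{i}+\dot{x}_2\hat{j}$, so that $(\nabla\times\mathbf{f})\times\dot{\mathbf{x}}=\left(\frac{\partial f_2}{\partial x_1}-\frac{\partial f_1}{\partial x_2}\right)(-\dot{x}_2\hat{i}+\dot{x}_1\hat{j})$. *)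

(* Defs.v *)
From Stdlib Require Import Reals.
From Coquelicot Require Import Coquelicot.
Open Scope R_scope.

Definition I01 (t : R) : Prop := 0 <= t <= 1.

(** Derivatives of functions of [t] in [[0,1]] are relative to that interval:
    one-sided at the two endpoints, and blind to the values outside it. *)
Definition is_derive01 (g : R -> R) (t l : R) : Prop :=
  filterdiff g (within I01 (locally t)) (fun h : R => scal h l).

Definition ex_derive01 (g : R -> R) (t : R) : Prop :=
  exists l : R, is_derive01 g t l.

(** Meaningful when [ex_derive01 g t] and [I01 t] hold. *)
Definition Derive01 (g : R -> R) (t : R) : R := iota (is_derive01 g t).

Definition C1_01 (g : R -> R) : Prop :=
  (forall t : R, I01 t -> ex_derive01 g t) /\ continuous_on I01 (Derive01 g).

Definition C2_01 (g : R -> R) : Prop :=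
  (forall t : R, I01 t -> ex_derive01 g t) /\ C1_01 (Derive01 g).

Definition constant01 (g : R -> R) : Prop :=
  forall s t : R, I01 s -> I01 t -> g s = g t.

Definition d1 (h : R * R -> R) (p : R * R) : R :=
  Derive (fun s : R => h (s, snd p)) (fst p).

Definition d2 (h : R * R -> R) (p : R * R) : R :=
  Derive (fun s : R => h (fst p, s)) (snd p).

Definition C1_plane (h : R * R -> R) : Prop :=
  (forall p : R * R,
      ex_derive (fun s : R => h (s, snd p)) (fst p) /\
      ex_derive (fun s : R => h (fst p, s)) (snd p)) /\
  (forall p : R * R, continuous (d1 h) p /\ continuous (d2 h) p).

Definition comp1 (f : R * R -> R * R) (p : R * R) : R := fst (f p).
Definition comp2 (f : R * R -> R * R) (p : R * R) : R := snd (f p).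

Definition C1_field (f : R * R -> R * R) : Prop :=
  C1_plane (comp1 f) /\ C1_plane (comp2 f).

Definition R3 : Type := (R * R * R)%type.

Definition cross (a b : R3) : R3 :=
  let '(a1, a2, a3) := a in
  let '(b1, b2, b3) := b in
  (a2 * b3 - a3 * b2, a3 * b1 - a1 * b3, a1 * b2 - a2 * b1).

Definition scale3 (c : R) (a : R3) : R3 :=
  let '(a1, a2, a3) := a in (c * a1, c * a2, c * a3).

Definition in_plane (v1 v2 : R) : R3 := (v1, v2, 0).

Definition curl (f : R * R -> R * R) (p : R * R) : R3 :=
  (0, 0, d1 (comp2 f) p - d2 (comp1 f) p).

Inductive coord : Set := X1 | X2 | X3 | Lam.

Definition coord_eq_dec (i j : coord) : {i = j} + {i <> j}.
Proof. decide equality. Defined.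

Definition config : Type := coord -> R.

Definition upd (q : config) (i : coord) (s : R) : config :=
  fun j => if coord_eq_dec j i then s else q j.

Definition partial (F : config -> R) (i : coord) (q : config) : R :=
  Derive (fun s : R => F (upd q i s)) (q i).

Definition curve (x1 x2 x3 lam : R -> R) (t : R) : config :=
  fun i => match i with
           | X1 => x1 t | X2 => x2 t | X3 => x3 t | Lam => lam t
           end.

Definition velocity (q : R -> config) (t : R) : config :=
  fun i => Derive01 (fun s : R => q s i) t.

(** [L q v], with positions [q] and velocities [v] as independent arguments:
    [d/dt (dL/dv_i) = dL/dq_i] along the curve for all four coordinates,
    the multiplier included. *)
Definition Euler_Lagrange (L : config -> config -> R) (q : R -> config) : Prop :=
  forall (i : coord) (t : R), I01 t ->
    is_derive01 (fun s : R => partial (L (q s)) i (velocity q s)) t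
      (partial (fun y : config => L y (velocity q t)) i (q t)).

Definition aug_Lagrangian (f : R * R -> R * R) (q v : config) : R :=
  v X1 ^ 2 + v X2 ^ 2
  + q Lam * (v X3 - comp1 f (q X1, q X2) * v X1 - comp2 f (q X1, q X2) * v X2).

(* Main.v *)
Require Import Defs.
From Stdlib Require Import Reals Lra.
From Coquelicot Require Import Coquelicot.
(* The partial derivatives [d1], [d2] are those of the plane, not the
   projections of the same names in [Ranalysis]. *)
Import Defs.
Open Scope R_scope.

(** The Lagrangian does not involve [x3] itself and its derivative in the
    velocity of [x3] is [lam], so the equation for [x3] says that [lam] has zero
    derivative: by the mean value theorem it is constant
    ([derive01_zero_constant01]).  The momentum conjugate to [x1] is
    [2 x1' - lam f1(x1,x2)].  Its time derivative, by the product and chain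
    rules, is [2 x1'' - lam (d1 f1 x1' + d2 f1 x2')] because [lam' = 0], while
    the force is [- lam (d1 f1 x1' + d1 f2 x2')].  The [d1 f1] terms cancel and
    what is left is [2 x1'' = - lam (d1 f2 - d2 f1) x2']; symmetrically
    [2 x2'' = lam (d1 f2 - d2 f1) x1'].  Both are the components of the magnetic
    equation with [mu = lam / 2].

    The derivatives along the curve are relative to [[0,1]], so the argument
    rests on uniqueness and the chain rule for [is_derive01]. *)

(** * Calculus of derivatives relative to the unit interval *)

Lemma within_I01_proper (t : R) :
  I01 t -> ProperFilter (within I01 (locally t)).
Proof.
  intros Ht; split.
  - intros P [d Hd]. exists t. exact (Hd t (ball_center t d) Ht).
  - apply within_filter, locally_filter.
Qed.

Lemma within_I01_lim (t : R) : is_filter_lim (within I01 (locally t)) t.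
Proof. intros P HP. apply filter_le_within; exact HP. Qed.

(** The reason why difference quotients within [[0,1]] determine the
    derivative. *)
Lemma I01_not_isolated (t : R) (d : posreal) :
  I01 t -> exists y : R, I01 y /\ y <> t /\ Rabs (y - t) < d.
Proof.
  intros [H0 H1]. destruct d as [d Hd]; simpl.
  pose proof (Rmin_l (d / 2) (1 / 2)). pose proof (Rmin_r (d / 2) (1 / 2)).
  assert (0 < Rmin (d / 2) (1 / 2)) by (apply Rmin_pos; lra).
  unfold I01. destruct (Rle_dec t (1 / 2)).
  - exists (t + Rmin (d / 2) (1 / 2)). repeat split; try lra.
    rewrite Rabs_pos_eq; lra.
  - exists (t - Rmin (d / 2) (1 / 2)). repeat split; try lra.
    rewrite Rabs_left; lra.
Qed.

Lemma is_derive01_unique (g : R -> R) (t l m : R) :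
  I01 t -> is_derive01 g t l -> is_derive01 g t m -> l = m.
Proof.
  intros Ht [_ Hl] [_ Hm].
  specialize (Hl t (within_I01_lim t)). specialize (Hm t (within_I01_lim t)).
  destruct (Req_dec l m) as [E | N]; [exact E | exfalso].
  assert (He : 0 < Rabs (l - m) / 4).
  { assert (0 < Rabs (l - m)) by (apply Rabs_pos_lt; lra). lra. }
  destruct (Hl (mkposreal _ He)) as [e1 H1].
  destruct (Hm (mkposreal _ He)) as [e2 H2].
  assert (Hd : 0 < Rmin e1 e2) by (apply Rmin_pos; apply cond_pos).
  destruct (I01_not_isolated t (mkposreal _ Hd) Ht) as (y & Iy & Ny & By).
  simpl in By.
  specialize (H1 y (Rlt_le_trans _ _ _ By (Rmin_l _ _)) Iy).
  specialize (H2 y (Rlt_le_trans _ _ _ By (Rmin_r _ _)) Iy).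
  change (Rabs (g y - g t - (y - t) * l) <= Rabs (l - m) / 4 * Rabs (y - t)) in H1.
  change (Rabs (g y - g t - (y - t) * m) <= Rabs (l - m) / 4 * Rabs (y - t)) in H2.
  assert (Hy : 0 < Rabs (y - t)) by (apply Rabs_pos_lt; lra).
  assert (T : Rabs (l - m) * Rabs (y - t)
              <= Rabs (g y - g t - (y - t) * l) + Rabs (g y - g t - (y - t) * m)).
  { rewrite <- Rabs_mult, (Rabs_minus_sym (g y - g t)).
    eapply Rle_trans; [| apply Rabs_triang]. right; f_equal; ring. }
  assert (0 < Rabs (l - m) * Rabs (y - t)) by (apply Rmult_lt_0_compat; lra).
  nra.
Qed.

Lemma Derive01_correct (g : R -> R) (t : R) :
  I01 t -> ex_derive01 g t -> is_derive01 g t (Derive01 g t).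
Proof.
  intros Ht [l Hl].
  apply (iota_correct (V := R_CompleteNormedModule) (is_derive01 g t)).
  exists l; split; [exact Hl |].
  intros m Hm. exact (is_derive01_unique g t l m Ht Hl Hm).
Qed.

Lemma is_derive01_ext (g h : R -> R) (t l : R) :
  (forall s, g s = h s) -> is_derive01 g t l -> is_derive01 h t l.
Proof.
  intros E. apply (filterdiff_ext (K := R_AbsRing) (U := R_NormedModule)
    (V := R_NormedModule) g h). exact E.
Qed.

Lemma is_derive01_comp2 (h : R -> R -> R) (a b : R -> R) (t la lb dx dy : R) :
  I01 t ->
  is_derive01 a t la -> is_derive01 b t lb ->
  filterdiff (fun u : R * R => h (fst u) (snd u)) (locally (a t, b t))
    (fun u : R * R => plus (scal (fst u) dx) (scal (snd u) dy)) ->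
  is_derive01 (fun s => h (a s) (b s)) t (la * dx + lb * dy).
Proof.
  intros Ht Ha Hb Hh.
  pose proof (within_I01_proper t Ht) as PF.
  apply (filterdiff_ext_lin (K := R_AbsRing) (U := R_NormedModule) (V := R_NormedModule) _
    (fun s => plus (scal (scal s la) dx) (scal (scal s lb) dy))).
  - apply (filterdiff_comp_2 (K := R_AbsRing) (T := R_NormedModule)
      (U := R_NormedModule) (V := R_NormedModule) (W := R_NormedModule)
      a b h (fun s => scal s la) (fun s => scal s lb)
      (fun x y => plus (scal x dx) (scal y dy)) Ha Hb).
    apply (filterdiff_locally (U := prod_NormedModule _ R_NormedModule R_NormedModule)
      _ (a t, b t)); [| exact Hh].
    intros P HP.
    assert (La : filterlim a (within I01 (locally t)) (locally (a t))).
    { apply (filterdiff_continuous_aux (K := R_AbsRing) (U := R_NormedModule)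
        (V := R_NormedModule) a); [eexists; exact Ha | apply within_I01_lim]. }
    assert (Lb : filterlim b (within I01 (locally t)) (locally (b t))).
    { apply (filterdiff_continuous_aux (K := R_AbsRing) (U := R_NormedModule)
        (V := R_NormedModule) b); [eexists; exact Hb | apply within_I01_lim]. }
    destruct HP as [e He].
    change (within I01 (locally t) (fun s => P (a s, b s))).
    apply (filter_imp (fun s => ball (a t) e (a s) /\ ball (b t) e (b s))).
    + intros s [B1 B2]. apply He. split; assumption.
    + apply filter_and; [apply La | apply Lb]; apply locally_ball.
  - intros y. unfold plus, scal; simpl; unfold mult; simpl. ring.
Qed.

Lemma is_derive01_mult (a b : R -> R) (t la lb : R) :
  I01 t -> is_derive01 a t la -> is_derive01 b t lb ->
  is_derive01 (fun s => a s * b s) t (la * b t + lb * a t).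
Proof.
  intros Ht Ha Hb. apply is_derive01_comp2; try assumption.
  eapply (filterdiff_ext_lin (K := R_AbsRing)
    (U := prod_NormedModule _ R_NormedModule R_NormedModule) (V := R_NormedModule)).
  - apply (filterdiff_mult (K := R_AbsRing) (F := locally (a t, b t)) (a t, b t)).
    + intros P HP; exact HP.
    + exact Rmult_comm.
  - intros [u v]. unfold plus, scal; simpl; unfold mult, plus; simpl. ring.
Qed.

Lemma is_derive01_lincomb (c : R) (a b : R -> R) (t la lb : R) :
  I01 t -> is_derive01 a t la -> is_derive01 b t lb ->
  is_derive01 (fun s => c * a s - b s) t (c * la - lb).
Proof.
  intros Ht Ha Hb.
  pose proof (within_I01_proper t Ht) as PF.
  eapply (filterdiff_ext_lin (K := R_AbsRing) (U := R_NormedModule) (V := R_NormedModule)).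
  - apply (filterdiff_minus_fct (K := R_AbsRing) (U := R_NormedModule)
      (V := R_NormedModule) (fun s => scal c (a s)) b); [| exact Hb].
    apply (filterdiff_scal_r_fct (K := R_AbsRing) (U := R_NormedModule)
      (V := R_NormedModule) c a); [exact Rmult_comm | exact Ha].
  - intros y. unfold minus, plus, opp, scal; simpl; unfold mult; simpl. ring.
Qed.

(** Continuity of one partial derivative around the point, with mere existence
    of the other, already gives total differentiability; the chain rule then
    applies. *)
Lemma is_derive01_C1_plane (h : R * R -> R) (a b : R -> R) (t la lb : R) :
  C1_plane h -> I01 t -> is_derive01 a t la -> is_derive01 b t lb ->
  is_derive01 (fun s => h (a s, b s)) t
    (la * d1 h (a t, b t) + lb * d2 h (a t, b t)).
Proof.
  intros [Hex Hc] Ht Ha Hb.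
  apply (is_derive01_comp2 (fun x y => h (x, y))); try assumption.
  apply (is_derive_filterdiff (fun x y => h (x, y)) (a t) (b t)
    (fun x y => d1 h (x, y))).
  - apply filter_forall. intros u. exact (Derive_correct _ _ (proj1 (Hex u))).
  - exact (Derive_correct _ _ (proj2 (Hex (a t, b t)))).
  - apply (continuous_ext (d1 h)).
    + intros [u v]; reflexivity.
    + exact (proj1 (Hc (a t, b t))).
Qed.

Definition clamp (t : R) : R := Rmax 0 (Rmin 1 t).

Lemma clamp_I01 (t : R) : I01 (clamp t).
Proof.
  split; [apply Rmax_l |].
  apply Rmax_lub; [lra | apply Rmin_l].
Qed.

Lemma clamp_id (t : R) : I01 t -> clamp t = t.
Proof.
  intros [H0 H1]. unfold clamp. rewrite Rmin_right, Rmax_right; lra.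
Qed.

Lemma clamp_nonexpansive (s t : R) : Rabs (clamp s - clamp t) <= Rabs (s - t).
Proof.
  unfold clamp, Rmax, Rmin.
  repeat destruct (Rle_dec _ _); apply Rabs_le;
    (split; unfold Rabs; destruct (Rcase_abs _); lra).
Qed.

(** The mean value theorem needs a function continuous in the two-sided sense at
    the endpoints, so it is applied to the extension of [g] that is constant on
    each side of [[0,1]]. *)
Lemma derive01_zero_constant01 (g : R -> R) :
  (forall t, I01 t -> is_derive01 g t 0) -> constant01 g.
Proof.
  intros Hg s t Hs Ht.
  destruct (MVT_gen (fun r => g (clamp r)) s t (fun _ => 0)) as (c & _ & Hc).
  - intros x Hx.
    assert (Ix : 0 < x < 1).
    { destruct Hs, Ht. revert Hx. unfold Rmin, Rmax; destruct (Rle_dec s t); lra. }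
    assert (Nx : locally x I01).
    { generalize (open_and _ _ (open_gt 0) (open_lt 1) x Ix).
      apply filter_imp. unfold I01; intros; lra. }
    apply (is_derive_ext_loc g).
    { revert Nx; apply filter_imp. intros r Hr; simpl. now rewrite clamp_id. }
    destruct (Hg x) as [Hlin Hd]; [unfold I01; lra |].
    split; [exact Hlin |].
    intros y Hy eps.
    apply (is_filter_lim_locally_unique (V := R_NormedModule)) in Hy; subst y.
    generalize (filter_and _ _ Nx (Hd x (within_I01_lim x) eps)).
    apply filter_imp. intros r [Ir Hr]. exact (Hr Ir).
  - intros x _.
    apply continuity_pt_filterlim.
    assert (Lg : filterlim g (within I01 (locally (clamp x))) (locally (g (clamp x)))).
    { apply (filterdiff_continuous_aux (K := R_AbsRing) (U := R_NormedModule)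
        (V := R_NormedModule) g); [| apply within_I01_lim].
      eexists; apply Hg, clamp_I01. }
    eapply filterlim_comp; [| exact Lg].
    intros P [d Hd]. exists d. intros y Hy. apply Hd; [| apply clamp_I01].
    exact (Rle_lt_trans _ _ _ (clamp_nonexpansive y x) Hy).
  - rewrite !clamp_id in Hc by assumption. lra.
Qed.

(** * Momenta and forces of the augmented Lagrangian *)

Lemma momentum1 (f : R * R -> R * R) (q v : config) :
  partial (aug_Lagrangian f q) X1 v
  = 2 * v X1 - q Lam * comp1 f (q X1, q X2).
Proof.
  apply is_derive_unique; unfold aug_Lagrangian, upd; simpl.
  auto_derive; [exact I | ring].
Qed.

Lemma momentum2 (f : R * R -> R * R) (q v : config) :
  partial (aug_Lagrangian f q) X2 v
  = 2 * v X2 - q Lam * comp2 f (q X1, q X2).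
Proof.
  apply is_derive_unique; unfold aug_Lagrangian, upd; simpl.
  auto_derive; [exact I | ring].
Qed.

Lemma momentum3 (f : R * R -> R * R) (q v : config) :
  partial (aug_Lagrangian f q) X3 v = q Lam.
Proof.
  apply is_derive_unique; unfold aug_Lagrangian, upd; simpl.
  auto_derive; [exact I | ring].
Qed.

(** Common form of both planar forces: [g1], [g2] are the sections of [f1], [f2]
    along the coordinate being varied, and the velocities are
    held fixed. *)
Lemma Derive_constraint (g1 g2 : R -> R) (k l a b c s : R) :
  ex_derive g1 s -> ex_derive g2 s ->
  Derive (fun r => k + l * (c - g1 r * a - g2 r * b)) s
  = - l * (Derive g1 s * a + Derive g2 s * b).
Proof.
  intros D1 D2. apply is_derive_unique.
  auto_derive; [now repeat split |].
  change (fun x : R => g1 x) with g1. change (fun x : R => g2 x) with g2. ring.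
Qed.

Lemma force1 (f : R * R -> R * R) (q v : config) :
  C1_field f ->
  partial (fun y => aug_Lagrangian f y v) X1 q
  = - q Lam * (d1 (comp1 f) (q X1, q X2) * v X1 + d1 (comp2 f) (q X1, q X2) * v X2).
Proof.
  intros [[E1 _] [E2 _]].
  exact (Derive_constraint (fun s => comp1 f (s, q X2)) (fun s => comp2 f (s, q X2))
    _ _ _ _ _ _ (proj1 (E1 (q X1, q X2))) (proj1 (E2 (q X1, q X2)))).
Qed.

Lemma force2 (f : R * R -> R * R) (q v : config) :
  C1_field f ->
  partial (fun y => aug_Lagrangian f y v) X2 q
  = - q Lam * (d2 (comp1 f) (q X1, q X2) * v X1 + d2 (comp2 f) (q X1, q X2) * v X2).
Proof.
  intros [[E1 _] [E2 _]].
  exact (Derive_constraint (fun s => comp1 f (q X1, s)) (fun s => comp2 f (q X1, s))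
    _ _ _ _ _ _ (proj2 (E1 (q X1, q X2))) (proj2 (E2 (q X1, q X2)))).
Qed.

Lemma force3 (f : R * R -> R * R) (q v : config) :
  partial (fun y => aug_Lagrangian f y v) X3 q = 0.
Proof.
  apply is_derive_unique; unfold aug_Lagrangian, upd; simpl.
  auto_derive; [exact I | ring].
Qed.

(** * The magnetic equation of motion *)

Lemma multiplier_derive_zero (f : R * R -> R * R) (x1 x2 x3 lam : R -> R) (t : R) :
  Euler_Lagrange (aug_Lagrangian f) (curve x1 x2 x3 lam) -> I01 t ->
  is_derive01 lam t 0.
Proof.
  intros hEL Ht. generalize (hEL X3 t Ht). rewrite force3.
  apply is_derive01_ext. intros s. apply momentum3.
Qed.

(** Time derivative of a momentum [2 x' - lam h(x1,x2)], in the form it takes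
    once the multiplier is known to be stationary. *)
Lemma momentum_derive01 (h : R * R -> R) (x x1 x2 lam : R -> R) (t : R) :
  C1_plane h -> C2_01 x -> C2_01 x1 -> C2_01 x2 -> I01 t ->
  is_derive01 lam t 0 ->
  is_derive01 (fun s => 2 * Derive01 x s - lam s * h (x1 s, x2 s)) t
    (2 * Derive01 (Derive01 x) t
     - lam t * (Derive01 x1 t * d1 h (x1 t, x2 t) + Derive01 x2 t * d2 h (x1 t, x2 t))).
Proof.
  intros Hh [_ [Hx _]] [Hx1 _] [Hx2 _] Ht Hlam.
  pose proof (is_derive01_C1_plane h x1 x2 t _ _ Hh Ht
    (Derive01_correct _ _ Ht (Hx1 t Ht)) (Derive01_correct _ _ Ht (Hx2 t Ht))) as Hc.
  pose proof (is_derive01_lincomb 2 _ _ t _ _ Ht (Derive01_correct _ _ Ht (Hx t Ht))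
    (is_derive01_mult _ _ t _ _ Ht Hlam Hc)) as H.
  match type of H with is_derive01 _ _ ?l =>
    match goal with |- is_derive01 _ _ ?m => replace m with l by ring end end.
  exact H.
Qed.

Theorem mainTheorem5 (f : R * R -> R * R) (x1 x2 x3 lam : R -> R)
  (hf : C1_field f)
  (hx1 : C2_01 x1) (hx2 : C2_01 x2) (hx3 : C2_01 x3) (hlam : C1_01 lam)
  (hEL : Euler_Lagrange (aug_Lagrangian f) (curve x1 x2 x3 lam)) :
  constant01 lam /\
  exists mu : R,
    (forall t : R, I01 t -> mu = lam t / 2) /\
    (forall t : R, I01 t ->
       in_plane (Derive01 (Derive01 x1) t) (Derive01 (Derive01 x2) t)
       = scale3 mu (cross (curl f (x1 t, x2 t))
                          (in_plane (Derive01 x1 t) (Derive01 x2 t)))).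
Proof.
  assert (Hl : forall t, I01 t -> is_derive01 lam t 0).
  { intros t. now apply (multiplier_derive_zero f x1 x2 x3). }
  assert (Hconst : constant01 lam) by now apply derive01_zero_constant01.
  split; [exact Hconst |].
  assert (I0 : I01 0) by (unfold I01; lra).
  exists (lam 0 / 2). split.
  { intros t Ht. now rewrite (Hconst 0 t I0 Ht). }
  intros t Ht. rewrite (Hconst 0 t I0 Ht).
  pose proof (hEL X1 t Ht) as E1. pose proof (hEL X2 t Ht) as E2.
  rewrite force1 in E1 by exact hf. rewrite force2 in E2 by exact hf.
  eapply is_derive01_ext in E1; [| intros s; apply momentum1].
  eapply is_derive01_ext in E2; [| intros s; apply momentum2].
  pose proof (is_derive01_unique _ t _ _ Ht E1
    (momentum_derive01 _ x1 x1 x2 lam t (proj1 hf) hx1 hx1 hx2 Ht (Hl t Ht))) as M1.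
  pose proof (is_derive01_unique _ t _ _ Ht E2
    (momentum_derive01 _ x2 x1 x2 lam t (proj2 hf) hx2 hx1 hx2 Ht (Hl t Ht))) as M2.
  unfold velocity, curve in M1, M2.
  change (fun s : R => x1 s) with x1 in M1, M2.
  change (fun s : R => x2 s) with x2 in M1, M2.
  unfold in_plane, curl, cross, scale3.
  f_equal; [f_equal |]; lra.
Qed.
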